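(* Let $(f_n)$ be the Fibonacci numbers with the indexing $f_0=1$, $f_1=1$ and $f_n=f_{n-1}+f_{n-2}$ for $n\ge 2$. For $n\ge 1$ let $F=(F_{ij})_{1\le i,j\le n}$ be the $n\times n$ tridiagonal matrix $$F=\left(\begin{array}{cccccc} 1 & -1 & 0 & \cdots & 0 & 0\\ 1 & 1 & -1 & \cdots & 0 & 0\\ 0 & 1 & 1 & \cdots & 0 & 0\\ \vdots & \vdots & \vdots & \ddots & \vdots & \vdots\\ 0 & 0 & 0 & \cdots & 1 & -1\\ 0 & 0 & 0 & \cdots & 1 & 1 \end{array}\right),$$ that is, $F_{ii}=1$, $F_{i,i+1}=-1$, $F_{i+1,i}=1$, and all other entries are $0$. Then $\det(F)=f_n$. *)

(* Defs.v *)
From mathcomp Require Import all_boot all_order all_algebra.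

Set Implicit Arguments.
Unset Strict Implicit.
Unset Printing Implicit Defensive.

Import GRing.Theory.

(* Shifted indexing: the sequence starts 1, 1, 2, 3, 5, ... *)
Fixpoint fib (n : nat) : nat :=
  if n is n'.+1 then
    if n' is n''.+1 then (fib n' + fib n'')%N else 1
  else 1.

Local Open Scope ring_scope.

(* Rows and columns are numbered from 0; being tridiagonal Toeplitz, the matrix
   is given by the same conditions on i and j as with numbering from 1. *)
Definition fib_mx (n : nat) : 'M[int]_n :=
  \matrix_(i < n, j < n)
    if j == i then 1
    else if j == i.+1 :> nat then -1
    else if i == j.+1 :> nat then 1
    else 0.

(* Main.v *)
Require Import Defs.
From mathcomp Require Import all_boot all_order all_algebra.

Import GRing.Theory.
Local Open Scope ring_scope.

(** Both sides satisfy the Fibonacci recurrence with the same initial values.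
    For the determinant, expand along the first row, whose only nonzero entries
    are 1 and -1. Since the matrix is Toeplitz, deleting the first row and
    column leaves the same matrix of size one less, which is the contribution
    of the entry 1. The minor of the entry -1 has first column (1, 0, ..., 0)^T,
    so expanding it along that column leaves the same matrix of size two less;
    the sign of this cofactor cancels the sign of the entry, so the two
    contributions are added ([det_fib_mx_rec]). *)

Lemma row'_col'_fib_mx (n : nat) :
  row' ord0 (col' ord0 (fib_mx n.+1)) = fib_mx n.
Proof. by apply/matrixP=> i j; rewrite !mxE (inj_eq lift_inj). Qed.

(** The first column of this minor is that of [fib_mx n.+2] without its top
    entry, so only its own top entry 1 contributes; below and to the right of
    that entry, the first two rows and columns have been removed. *)
Lemma det_minor01_fib_mx (n : nat) :
  \det (row' ord0 (col' (lift ord0 ord0) (fib_mx n.+2))) = \det (fib_mx n).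
Proof.
rewrite (expand_det_col _ ord0) big_ord_recl big1 => [|i _]; last first.
  by rewrite !mxE mul0r.
rewrite !mxE mul1r addr0 /cofactor expr0 mul1r.
congr (\det _); apply/matrixP=> i j.
by rewrite !mxE -!val_eqE.
Qed.

Lemma det_fib_mx_rec (n : nat) :
  \det (fib_mx n.+2) = \det (fib_mx n.+1) + \det (fib_mx n).
Proof.
rewrite (expand_det_row _ ord0) !big_ord_recl big1 => [|j _]; last first.
  by rewrite !mxE mul0r.
rewrite /cofactor row'_col'_fib_mx det_minor01_fib_mx !mxE /=.
by rewrite addr0 expr0 expr1 !mul1r !mulN1r opprK.
Qed.

Theorem corollary6 (n : nat) (hn : (1 <= n)%N) :
  \det (fib_mx n) = (fib n)%:Z.
Proof.
clear hn.
(* The recurrence has order two, so two consecutive values are carried. *)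
suff [] : \det (fib_mx n) = (fib n)%:Z /\ \det (fib_mx n.+1) = (fib n.+1)%:Z.
  by [].
elim: n => [|n [IHn IHn1]].
  by rewrite det_mx00 det_mx11 mxE.
by split=> //; rewrite det_fib_mx_rec IHn IHn1 -PoszD.
Qed.
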